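(* For integers $t\ge s\ge 0$ and $n\ge 1$, and an indeterminate $\mu$, \[ D_{s,t}(n)=\left(\prod_{i=0}^{t-s-1}\frac{(\mu+i+s-1)_n}{(i+s+1)_n}\right)\cdot D_{t,s}(n). \]
   Context: $\mu$ is an indeterminate and all quantities lie in $\mathbb{Q}(\mu)$. For integers $s,t$ and $n\ge1$, $D_{s,t}(n)$ denotes the $n\times n$ determinant $\det\bigl(\delta_{i,j}+\binom{\mu+i+j-2}{j}\bigr)$ with row index $i$ running over $s\le i<s+n$ and column index $j$ over $t\le j<t+n$; here $\delta_{i,j}$ is the Kronecker delta and $\binom{x}{j}=x(x-1)\cdots(x-j+1)/j!$ for integers $j\ge0$, $\binom{x}{j}=0$ for $j<0$. The Pochhammer symbol is $(x)_k=x(x+1)\cdots(x+k-1)$ for $k>0$, $(x)_0=1$. An empty product equals $1$. *)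

(* Defs.v *)
From HB Require Import structures.
From mathcomp Require Import all_boot all_order all_algebra.

Set Implicit Arguments.
Unset Strict Implicit.
Unset Printing Implicit Defensive.

Import Order.TTheory GRing.Theory Num.Theory.
Local Open Scope ring_scope.

Notation Qmu := {fraction {poly rat}}.

Definition mu : Qmu := tofrac ('X : {poly rat}).

Definition pochhammer (F : fieldType) (x : F) (k : nat) : F :=
  \prod_(0 <= l < k) (x + l%:R).

Definition gbinom (F : fieldType) (x : F) (j : int) : F :=
  match j with
  | Posz k => (\prod_(0 <= l < k) (x - l%:R)) / (k`!)%:R
  | Negz _ => 0
  end.

Definition entry (i j : int) : Qmu :=
  (i == j)%:R + gbinom (mu + (i + j - 2)%:~R) j.

(* The ordinals are 0-based offsets: the actual row and column indices are
   s + i and t + j, and it is these that the Kronecker delta compares. *)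
Definition D (s t : int) (n : nat) : Qmu :=
  \det (\matrix_(i < n, j < n) entry (s + i%:Z) (t + j%:Z)).

(* Main.v *)
(** Put [w k = (mu - 1)_k / k!].  Since
    [binom (mu + i + j - 2) j = (mu - 1)_(i + j) / (j! (mu - 1)_i)],
    [w i * entry i j] is symmetric in [i] and [j].  Hence the two matrices are
    transposes of one another up to diagonal scaling by [w], and the product
    in the theorem is the telescoped ratio of the determinants of the two
    scalings. *)
Require Import Defs.
From HB Require Import structures.
From mathcomp Require Import all_boot all_order all_algebra.
From mathcomp Require Import ring.

Set Implicit Arguments.
Unset Strict Implicit.
Unset Printing Implicit Defensive.

Import Order.TTheory GRing.Theory Num.Theory.
Local Open Scope ring_scope.

(** [mu + z] is the image of a monic linear polynomial; this is what makes every weight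
    invertible. *)
Lemma muDint_neq0 (z : int) : mu + z%:~R != 0.
Proof.
rewrite /mu -(rmorph_int (@tofrac {poly rat})) -rmorphD tofrac_eq0.
have -> : 'X + z%:~R = 'X - (- z%:~R)%:P :> {poly rat}.
  by rewrite polyCN opprK rmorph_int.
by rewrite polyXsubC_eq0.
Qed.

Lemma natQmu_neq0 (k : nat) : (k.+1)%:R != 0 :> Qmu.
Proof.
rewrite -(rmorph_nat (@tofrac {poly rat})) tofrac_eq0.
by rewrite -(rmorph_nat polyC) polyC_eq0 pnatr_eq0.
Qed.

Lemma factQmu_neq0 (k : nat) : (k`!)%:R != 0 :> Qmu.
Proof. by case: k`! (fact_gt0 k) => // m _; apply: natQmu_neq0. Qed.

Lemma pochhammerS (F : fieldType) (x : F) (k : nat) :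
  pochhammer x k.+1 = pochhammer x k * (x + k%:R).
Proof. by rewrite /pochhammer big_nat_recr. Qed.

Lemma pochhammerD (F : fieldType) (x : F) (m k : nat) :
  pochhammer x (m + k) = pochhammer x m * pochhammer (x + m%:R) k.
Proof.
elim: k => [|k IHk]; first by rewrite addn0 [pochhammer _ 0]big_geq ?mulr1.
by rewrite addnS !pochhammerS IHk natrD addrA mulrA.
Qed.

(** Reversing the order of the factors turns the falling product into the rising one. *)
Lemma gbinom_pochhammer (F : fieldType) (x : F) (k : nat) :
  gbinom (x + k%:R - 1) k = pochhammer x k / (k`!)%:R.
Proof.
rewrite /gbinom /pochhammer big_nat_rev /=; congr (_ / _).
rewrite !big_mkord; apply: eq_bigr => i _.
rewrite add0n natrB //; ring.
Qed.

Lemma pochhammer_mu_neq0 (k : nat) : pochhammer (mu - 1) k != 0.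
Proof.
rewrite /pochhammer big_mkord; apply/prodf_neq0 => l _.
have -> : mu - 1 + l%:R = mu + (l%:Z - 1)%:~R by rewrite intrD; ring.
exact: muDint_neq0.
Qed.

Definition weight (k : nat) : Qmu := pochhammer (mu - 1) k / (k`!)%:R.

Lemma weight_neq0 (k : nat) : weight k != 0.
Proof. by rewrite mulf_neq0 ?invr_neq0 ?pochhammer_mu_neq0 ?factQmu_neq0. Qed.

(** The binomial is [(mu - 1 + a)_b / b!], whose numerator continues the factor [(mu - 1)_a] of
    [weight a]. *)
Lemma weight_gbinom (a b : nat) :
  weight a * gbinom (mu + (a%:Z + b%:Z - 2)%:~R) b =
  pochhammer (mu - 1) (a + b) / ((a`!)%:R * (b`!)%:R).
Proof.
have -> : mu + (a%:Z + b%:Z - 2)%:~R = (mu - 1 + a%:R) + b%:R - 1.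
  rewrite !intrD; ring.
by rewrite gbinom_pochhammer pochhammerD mulrACA -invfM.
Qed.

Lemma weight_entryC (a b : nat) :
  weight a * entry a b = weight b * entry b a.
Proof.
rewrite /entry !mulrDr !weight_gbinom addnC [_`!%:R * _]mulrC; congr (_ + _).
(* The Kronecker terms vanish unless [a = b], where the two weights coincide. *)
by rewrite [b%:Z == _]eq_sym; case: eqP => [[->]|]; rewrite ?mulr0.
Qed.

Lemma D_transpose (s t n : nat) :
  (\prod_(i < n) weight (s + i)) * D s t n =
  (\prod_(i < n) weight (t + i)) * D t s n.
Proof.
pose W k : 'rV_n := \row_(i < n) weight (k + i).
have detW k : \det (diag_mx (W k)) = \prod_(i < n) weight (k + i).
  by rewrite det_diag; apply: eq_bigr => i _; rewrite mxE.
(* Weights scale the rows of the first matrix and the columns of the transposed second one. *)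
rewrite -!detW [RHS]mulrC -[D t s n]det_tr -!det_mulmx; congr (\det _).
apply/matrixP => i j; rewrite mul_diag_mx mul_mx_diag !mxE.
by rewrite -!PoszD weight_entryC mulrC.
Qed.

Lemma weight_step (k : nat) :
  (mu - 1 + k%:R) / (k.+1)%:R = weight k.+1 / weight k.
Proof.
rewrite {1}/weight pochhammerS factS natrM [_ * (_ + k%:R)]mulrC.
by rewrite -[X in X / weight k]mulf_div mulfK ?weight_neq0.
Qed.

(** Factor by factor, this is [weight_step] at [k + l]; it prepares the telescoping in [k]. *)
Lemma pochhammer_ratio (k n : nat) :
  pochhammer (mu - 1 + k%:R) n / pochhammer (k.+1)%:R n =
  \prod_(l < n) (weight (k + l).+1 / weight (k + l)).
Proof.
rewrite /pochhammer -prodf_div big_mkord; apply: eq_bigr => l _.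
by rewrite -addrA -!natrD addSn weight_step.
Qed.

Theorem theorem17 (s t : int) (n : nat) (hs : 0 <= s) (hst : s <= t)
    (hn : (0 < n)%N) :
  D s t n =
    (\prod_(0 <= i < `|t - s|%N)
        (pochhammer (mu + (i%:Z + s - 1)%:~R) n
         / pochhammer ((i%:Z + s + 1)%:~R) n)) * D t s n.
Proof.
case: s hs hst => // s _; case: t => // t; rewrite lez_nat => hst.
have Ws_neq0 : \prod_(l < n) weight (s + l) != 0.
  by apply/prodf_neq0 => l _; apply: weight_neq0.
(* With [D t s n] cancelled, only an identity between products of weights remains. *)
apply: (mulfI Ws_neq0); rewrite D_transpose mulrA; congr (_ * _).
have -> : `|t%:Z - s%:Z|%N = (t - s)%N by rewrite subzn.
under eq_bigr => i _.
  have -> : mu + (i%:Z + s%:Z - 1)%:~R = mu - 1 + (i + s)%:R.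
    by rewrite !intrD natrD; ring.
  have -> : (i%:Z + s%:Z + 1)%:~R = ((i + s).+1)%:R :> Qmu.
    by rewrite !intrD -addn1 !natrD.
  rewrite pochhammer_ratio; over.
(* For fixed [l], the product over [i] telescopes from [weight (s + l)] to [weight (t + l)]. *)
rewrite exchange_big -big_split /=; apply: eq_bigr => l _.
have -> : \prod_(0 <= i < t - s) (weight (i + s + l).+1 / weight (i + s + l)) =
          weight (t + l) / weight (s + l).
  (* The telescoping lemma is applied to a nonempty range, so [s = t] is treated apart. *)
  move: hst; rewrite leq_eqVlt => /predU1P[<-|lt_st].
    by rewrite subnn big_geq // divff ?weight_neq0.
  rewrite (telescope_prodf (f := fun i => weight (i + s + l))) ?subn_gt0 //.
    by rewrite add0n subnK // ltnW.
  by move=> i _; apply: weight_neq0.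
by rewrite mulrC divfK // weight_neq0.
Qed.
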